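(* For every integer $k\ge 2$ there is a transition system $S_k$ with $n\in O(2^k k)$ vertices, $m\in O(2^k k^2)$ edges and constant labelling function, such that $\operatorname{bcost}(\alpha)\in\Omega((m+n)\log n)$, where $\alpha$ is the unit partition of $V(S_k)$.
   Context: A transition system is $S=(V,E,\lambda)$ where $(V,E)$ is a directed graph and $\lambda$ assigns a label to each vertex; $N^+(v)$ is the out-neighbourhood of $v$. A bisimulation is an equivalence relation $\sim$ on $V$ such that whenever $v\sim w$: $\lambda(v)=\lambda(w)$, and for every $v'\in N^+(v)$ there is $w'\in N^+(w)$ with $v'\sim w'$ (and symmetrically). For a partition $\pi$ of $V$ and $\pi$-closed sets $R,S$ (unions of cells), the refining operation $(R,S)$ yields the partition in which cells of $\pi$ disjoint from $S$ are unchanged and two vertices $v,w\in S$ are in the same cell iff they were in the same cell of $\pi$ and for every cell $C\in\pi$ with $C\subseteq R$: $N^+(v)\cap C\neq\emptyset \iff N^+(w)\cap C\neq\emptyset$. It is effective if it changes the partition. Its cost $\operatorname{bcost}(R,S)$ is the number of edges from a vertex in $S$ to a vertex in $R$. For a partition $\alpha$, $\operatorname{bcost}(\alpha)$ is the minimum, over all sequences of effective refining operations transforming $\alpha$ into the coarsest bisimulation (as a partition) refining $\alpha$, of the sum of the costs of the operations (equivalently, defined recursively: $0$ if the current partition is already such that no effective operation exists, and otherwise the minimum over effective $(R,S)$ of $\operatorname{bcost}(R,S)$ plus the cost of the resulting partition). The unit partition is $\{V\}$. *)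

(* Defs.v *)
From mathcomp Require Import classical_sets.
From mathcomp Require Import all_boot.

Set Implicit Arguments.
Unset Strict Implicit.
Unset Printing Implicit Defensive.

(* Edges form an arbitrary relation: loops are allowed, parallel edges are
   not. *)
Record transition_system := TransitionSystem {
  vertex :> finType;
  edge : rel vertex;
  label_type : Type;
  label : vertex -> label_type
}.

Definition nb_vertices (T : transition_system) : nat := #|T|.

Definition nb_edges (T : transition_system) : nat :=
  #|[set p : T * T | edge p.1 p.2]|.

Definition constant_label (T : transition_system) : Prop :=
  forall v w : T, label v = label w.

Definition outn (T : transition_system) (v : T) : {set T} :=
  [set w | edge v w].

Definition bisimulation (T : transition_system) (r : rel T) : Prop :=
  equivalence_rel r /\
  forall v w : T, r v w ->
    [/\ label v = label w,
        forall v', v' \in outn v -> exists2 w', w' \in outn w & r v' w'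
      & forall w', w' \in outn w -> exists2 v', v' \in outn v & r v' w'].

(* Only meaningful when P is a partition of the whole type: pblock P v is then
   the cell of v. *)
Definition same_cell (V : finType) (P : {set {set V}}) : rel V :=
  fun v w => pblock P v == pblock P w.

Definition bisimulation_partition (T : transition_system)
    (P : {set {set T}}) : Prop :=
  partition P [set: T] /\ bisimulation (same_cell P).

Definition refines (V : finType) (P Q : {set {set V}}) : Prop :=
  forall C, C \in P -> exists2 D, D \in Q & C \subset D.

Definition coarsest_bisimulation (T : transition_system)
    (alpha P : {set {set T}}) : Prop :=
  [/\ bisimulation_partition P, refines P alpha &
      forall Q : {set {set T}},
        bisimulation_partition Q -> refines Q alpha -> refines Q P].

Definition unit_partition (V : finType) : {set {set V}} := [set [set: V]].

(* The unions of cells of P. *)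
Definition closed_sets (V : finType) (P : {set {set V}}) : {set {set V}} :=
  [set cover Q | Q in powerset P].

Definition same_hits (T : transition_system) (P : {set {set T}})
    (A : {set T}) : rel T :=
  fun v w => [forall (C | (C \in P) && (C \subset A)),
    (outn v :&: C != finset.set0) == (outn w :&: C != finset.set0)].

(* Meant for A and B in closed_sets P: the cells of P inside B are split
   according to the cells of P inside A. *)
Definition refine (T : transition_system) (P : {set {set T}})
    (A B : {set T}) : {set {set T}} :=
  [set C in P | [disjoint C & B]] :|:
  equivalence_partition (fun v w => same_cell P v w && same_hits P A v w) B.

Definition op_cost (T : transition_system) (A B : {set T}) : nat :=
  #|[set p : T * T | [&& p.1 \in B, p.2 \in A & edge p.1 p.2]]|.

Fixpoint effective_ops (T : transition_system) (P : {set {set T}})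
    (ops : seq ({set T} * {set T})) : bool :=
  if ops is (A, B) :: ops' then
    [&& A \in closed_sets P, B \in closed_sets P, refine P A B != P
      & effective_ops (refine P A B) ops']
  else true.

Definition run_ops (T : transition_system) (P : {set {set T}})
    (ops : seq ({set T} * {set T})) : {set {set T}} :=
  foldl (fun Q o => refine Q o.1 o.2) P ops.

Definition ops_cost (T : transition_system)
    (ops : seq ({set T} * {set T})) : nat :=
  \sum_(o <- ops) op_cost o.1 o.2.

Definition refining_sequence (T : transition_system) (alpha : {set {set T}})
    (ops : seq ({set T} * {set T})) : Prop :=
  effective_ops alpha ops /\ coarsest_bisimulation alpha (run_ops alpha ops).

Definition is_bcost (T : transition_system) (alpha : {set {set T}})
    (c : nat) : Prop :=
  (exists2 ops, refining_sequence alpha ops & ops_cost ops = c) /\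
  forall ops, refining_sequence alpha ops -> c <= ops_cost ops.

(* The default value 0 is only taken when no refining sequence exists (e.g.
   when some cell of alpha contains vertices with different labels, which
   refining operations ignore), so it never helps a lower bound on bcost. *)
Definition bcost (T : transition_system) (alpha : {set {set T}}) : nat :=
  xget 0 (is_bcost alpha).

(* Main.v *)
Require Import Defs.
From mathcomp Require Import boolp classical_sets reals topology exp.
From mathcomp Require Import all_boot all_order all_algebra zify lra.

Set Implicit Arguments.
Unset Strict Implicit.
Unset Printing Implicit Defensive.

(** Words i of k bits index vertices x_i and k+1 twins y_{i,c}, with edges
    y_{i,c} -> x_i.  For a prefix w, the block Y_w can only be cut by hitting X_{w0}
    or X_{w1}, and the edges of x_i (to y_{i,0} and, for each later bit of i that is
    set, to a canonical vertex of the sibling of a shorter block) keep X_{w0} and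
    X_{w1} uncut as long as Y_w is uncut.  Hence every Y_w is cut exactly into Y_{w0}
    and Y_{w1}, at the price of all edges from one half of Y_w to the matching half
    of X_w.  In a bisimulation all words are distinguished, so each of the k levels
    costs at least (k+1) 2^k / 2, whereas the system has only O(2^k k) vertices and
    edges.  The sink separates x- from y-vertices, and loops on the x_i with first
    bit 1 start the process. *)

(** * Partitions and refining operations *)

Section Cells.
Variables (V : finType) (P : {set {set V}}).
Hypothesis partP : partition P [set: V].

Lemma cover_partitionT v : v \in cover P.
Proof. by rewrite (cover_partition partP) inE. Qed.

Lemma same_cellE v w : same_cell P v w = (w \in pblock P v).
Proof.
by rewrite /same_cell eq_pblock ?cover_partitionT //; case/and3P: partP.
Qed.

Lemma same_cell_in (C : {set V}) v w :
  C \in P -> same_cell P v w -> (v \in C) = (w \in C).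
Proof.
have /and3P[_ tP _] := partP.
have cellE u : C \in P -> (u \in C) = (pblock P u == C).
  move=> CP; apply/idP/eqP => [uC | <-]; first exact: def_pblock.
  by rewrite mem_pblock cover_partitionT.
by move=> CP /eqP e; rewrite !cellE // e.
Qed.

Lemma closed_same_cell (B : {set V}) v w :
  B \in closed_sets P -> same_cell P v w -> (v \in B) = (w \in B).
Proof.
case/imsetP=> Q; rewrite inE => /subsetP sQP ->{B} vw.
apply/bigcupP/bigcupP => -[C CQ Cv]; exists C => //.
  by rewrite -(same_cell_in (sQP _ CQ) vw).
by rewrite (same_cell_in (sQP _ CQ) vw).
Qed.

Lemma setT_closed : [set: V] \in closed_sets P.
Proof.
by apply/imsetP; exists P; rewrite ?powersetE // (cover_partition partP).
Qed.

Lemma same_cell_equivalence : equivalence_rel (same_cell P).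
Proof. by move=> u v w; split=> [|/eqP]; rewrite /same_cell ?eqxx // => ->. Qed.

Lemma partition_same_cell :
  equivalence_partition (same_cell P) [set: V] = P.
Proof.
rewrite -[RHS](equivalence_partition_pblock partP).
by apply: eq_imset => v; apply/setP=> w; rewrite !inE same_cellE.
Qed.

End Cells.

Lemma refinesP (V : finType) (P Q : {set {set V}}) :
  partition P [set: V] -> partition Q [set: V] ->
  (refines P Q <-> forall v w, same_cell P v w -> same_cell Q v w).
Proof.
move=> pP pQ; split=> [ref v w | sub C CP].
  rewrite !same_cellE // => vw.
  have [D DQ /subsetP sD] := ref _ (pblock_mem (cover_partitionT pP v)).
  have /and3P[_ tQ _] := pQ.
  rewrite (def_pblock tQ DQ (sD v _)) ?sD //.
  by rewrite mem_pblock cover_partitionT.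
have /and3P[_ tP nP] := pP.
have /set0Pn[v vC] : C != set0 by apply: contra nP => /eqP <-.
exists (pblock Q v); first by rewrite pblock_mem ?cover_partitionT.
apply/subsetP=> w wC; rewrite -same_cellE //; apply: sub.
by rewrite same_cellE // (def_pblock tP CP vC).
Qed.

Lemma unit_partitionP (V : finType) (v : V) :
  partition (unit_partition V) [set: V].
Proof.
apply/and3P; split; first by rewrite /cover big_set1.
  by apply/trivIsetP=> A B; rewrite !inE => /eqP-> /eqP->; rewrite eqxx.
by rewrite inE eq_sym; apply/set0Pn; exists v.
Qed.

Lemma same_cell_unit (V : finType) (v w : V) :
  same_cell (unit_partition V) v w.
Proof.
by rewrite (same_cellE (unit_partitionP v)) (@def_pblock _ _ setT) ?inE //;
  case/and3P: (unit_partitionP v).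
Qed.

Section Refine.
Variables (T : transition_system) (P : {set {set T}}) (A B : {set T}).
Hypotheses (partP : partition P [set: T]) (closedB : B \in closed_sets P).

(** Refining is one equivalence on all vertices, the hit condition being vacuous outside [B]. That
    it is an equivalence and agrees with [refine] rests on [B] containing each cell entirely or not
    at all. *)
Let R v w := same_cell P v w && ((v \in B) ==> same_hits P A v w).

Lemma same_hits_refl v : same_hits P A v v.
Proof. by apply/forall_inP. Qed.

Lemma same_hits_sym v w : same_hits P A v w = same_hits P A w v.
Proof.
by apply/forall_inP/forall_inP => h C /h /eqP ->; rewrite eqxx.
Qed.

Lemma same_hits_trans u v w :
  same_hits P A u v -> same_hits P A v w -> same_hits P A u w.
Proof.
move=> /forall_inP h1 /forall_inP h2; apply/forall_inP=> C CPA.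
by rewrite (eqP (h1 C CPA)) h2.
Qed.

Let R_equiv : {in [set: T] & &, equivalence_rel R}.
Proof.
move=> u v w _ _ _; split=> [|/andP[/eqP uv h]].
  by rewrite /R /same_cell eqxx same_hits_refl implybT.
have uvc : same_cell P u v by rewrite /same_cell uv.
rewrite /R (closed_same_cell partP closedB uvc) /same_cell uv.
congr (_ && _); move: h; rewrite (closed_same_cell partP closedB uvc).
case: (v \in B) => //= h; apply/idP/idP; last exact: same_hits_trans.
by apply: same_hits_trans; rewrite same_hits_sym.
Qed.

Let refineE : refine P A B = equivalence_partition R [set: T].
Proof.
have /and3P[_ tP nP] := partP.
have offB v : v \notin B -> [set w in [set: T] | R v w] = pblock P v.
  by move=> vB; apply/setP=> w; rewrite !inE /R (negPf vB) andbT -same_cellE.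
have inB v : v \in B -> [set w in [set: T] | R v w] =
    [set w in B | same_cell P v w && same_hits P A v w].
  move=> vB; apply/setP=> w; rewrite !inE /R vB /=.
  case: (boolP (same_cell P v w)) => [vw|]; last by rewrite andbF.
  by rewrite -(closed_same_cell partP closedB vw) vB.
apply/setP=> C; rewrite 2!inE; apply/orP/imsetP => [[/andP[CP CB]|]|[v _ ->]].
- have /set0Pn[v vC] : C != set0 by apply: contra nP => /eqP <-.
  exists v; rewrite ?inE // offB ?(def_pblock tP CP vC) //.
  by move/pred0P/(_ v): CB => /=; rewrite vC /= => ->.
- by case/imsetP=> v vB ->; exists v; rewrite ?inE ?inB.
have [vB | vB] := boolP (v \in B); [right | left].
  by rewrite inB //; apply/imsetP; exists v.
rewrite offB // pblock_mem ?cover_partitionT //=.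
apply/pred0P=> w /=; apply/negP=> /andP[vw wB].
by rewrite -same_cellE // in vw; rewrite (closed_same_cell partP closedB vw) wB in vB.
Qed.

Lemma refine_partition : partition (refine P A B) [set: T].
Proof. by rewrite refineE; apply: equivalence_partitionP. Qed.

Lemma same_cell_refine v w : same_cell (refine P A B) v w =
  same_cell P v w && ((v \in B) ==> same_hits P A v w).
Proof.
rewrite same_cellE ?refine_partition // refineE.
by rewrite pblock_equivalence_partition ?inE.
Qed.

End Refine.

(** A successor is matched inside its own cell of [Q], hence inside one cell of [P]; so no operation
    separates bisimilar vertices. *)
Lemma bisimulation_same_hits (T : transition_system) (P Q : {set {set T}}) A v w :
  partition P [set: T] -> bisimulation (same_cell Q) ->
  (forall v w, same_cell Q v w -> same_cell P v w) ->
  same_cell Q v w -> same_hits P A v w.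
Proof.
move=> pP [_ bis] sub vw; have [_ fwd bwd] := bis _ _ vw.
apply/forall_inP=> C /andP[CP _]; apply/eqP.
apply/set0Pn/set0Pn => -[u /setIP[uo uC]].
  have [u' u'o /sub uu'] := fwd _ uo; exists u'.
  by rewrite in_setI u'o -(same_cell_in pP CP uu').
have [u' u'o /sub uu'] := bwd _ uo; exists u'.
by rewrite in_setI u'o (same_cell_in pP CP uu').
Qed.

Lemma stable_bisimulation (T : transition_system) (P : {set {set T}}) :
  constant_label T -> partition P [set: T] ->
  (forall v w, same_cell P v w -> same_hits P [set: T] v w) ->
  bisimulation (same_cell P).
Proof.
move=> lab pP st; split; first exact: same_cell_equivalence.
have fwd v w : same_cell P v w ->
    forall v', v' \in outn v -> exists2 w', w' \in outn w & same_cell P v' w'.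
  move=> /st /forall_inP h v' v'o.
  have CP : pblock P v' \in P by rewrite pblock_mem ?cover_partitionT.
  have : outn v :&: pblock P v' != set0.
    by apply/set0Pn; exists v'; rewrite inE v'o mem_pblock cover_partitionT.
  rewrite (eqP (h _ _)) ?CP ?subsetT // => /set0Pn[w' /setIP[w'o w'C]].
  by exists w'; rewrite // same_cellE.
move=> v w vw; split=> //; first exact: fwd.
move=> w' w'o; have wv : same_cell P w v by rewrite /same_cell eq_sym.
by have [v' ? ?] := fwd _ _ wv _ w'o; exists v'; rewrite // /same_cell eq_sym.
Qed.

(** The operation with both arguments [setT] is repeated until it has no effect; the result is
    stable, and no bisimulation was cut on the way. *)
Lemma refining_sequence_exists (T : transition_system) (alpha : {set {set T}}) :
  constant_label T -> partition alpha [set: T] ->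
  exists ops, refining_sequence alpha ops.
Proof.
move=> lab pa.
suff reach P : partition P [set: T] -> refines P alpha ->
    (forall Q, bisimulation_partition Q -> refines Q alpha -> refines Q P) ->
    exists ops, effective_ops P ops /\ coarsest_bisimulation alpha (run_ops P ops).
  by apply: reach => // C CP; exists C.
(* Termination: an effective step strictly lowers the number of pairs of vertices sharing a cell. *)
have [n] := ubnP #|[set p : T * T | same_cell P p.1 p.2]|.
elim: n P => // n IHn P ltn pP refP leP.
pose P' := refine P setT setT.
have pP' : partition P' [set: T] by apply: refine_partition (setT_closed _).
have P'E v w : same_cell P' v w = same_cell P v w && same_hits P setT v w.
  by rewrite same_cell_refine ?setT_closed // inE.
have [eqP' | neP'] := eqVneq P' P.
  exists [::]; split=> //; split=> //; split=> //.
  by apply: stable_bisimulation => // v w; rewrite -{1}eqP' P'E => /andP[].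
have sub v w : same_cell P' v w -> same_cell P v w by rewrite P'E => /andP[].
have [] := IHn P' => //.
- rewrite ltnS in ltn; apply: leq_trans ltn.
  rewrite proper_card // properEneq; apply/andP; split; last first.
    by apply/subsetP=> -[v w]; rewrite !inE /=; apply: sub.
  apply: contra neP' => /eqP/setP eqR; apply/eqP.
  rewrite -(partition_same_cell pP') -(partition_same_cell pP).
  apply: eq_imset => v; apply/setP=> w; rewrite !inE /=.
  by have := eqR (v, w); rewrite !inE.
- by apply/refinesP => // v w /sub; move: v w; apply/refinesP.
- move=> Q bQ ra; have [pQ bisQ] := bQ; apply/refinesP => // v w vw.
  have subQ : forall v w, same_cell Q v w -> same_cell P v w.
    by apply/refinesP => //; apply: leP.
  by rewrite P'E subQ //= (bisimulation_same_hits _ pP bisQ).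
by move=> ops [eff co]; exists ((setT, setT) :: ops); rewrite /= !setT_closed // neP'.
Qed.

(** Some refining sequence exists, hence also a least cost, so [xget] does not fall back on its
    default 0. *)
Lemma bcost_attained (T : transition_system) (alpha : {set {set T}}) :
  constant_label T -> partition alpha [set: T] ->
  exists2 ops, refining_sequence alpha ops & ops_cost ops = bcost alpha.
Proof.
move=> lab pa; rewrite /bcost; case: xgetP => [c _ [] // | none].
pose attained c := `[< exists2 ops, refining_sequence alpha ops & ops_cost ops = c >].
have ex : exists c, attained c.
  have [ops opsP] := refining_sequence_exists lab pa.
  by exists (ops_cost ops); apply/asboolP; exists ops.
case: (ex_minnP ex) => c /asboolP cP cmin; case: (none c); split=> // ops opsP.
by apply: cmin; apply/asboolP; exists ops.
Qed.

(** * The hard transition systems *)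

Section Hard.
Variable k : nat.

Notation word := {ffun 'I_k -> bool}.
Notation hard_vertex := (option (word + word * 'I_k.+1)).

Definition sink : hard_vertex := None.
Definition xv (i : word) : hard_vertex := Some (inl i).
Definition yv (i : word) (c : 'I_k.+1) : hard_vertex := Some (inr (i, c)).

Definition flip (l : 'I_k) (i : word) : word := [ffun p => (p == l) (+) i p].

(* Flips the bit just before p and resets all later ones: the padding makes the
   word depend on the first p bits of i only. *)
Definition cut (p : 'I_k) (i : word) : word :=
  [ffun q : 'I_k => if q.+1 < p then i q else (q.+1 == p) && ~~ i q].

(** Set bits of [i] become edges: bit 0 a loop, having no earlier bit to flip, and bit [p > 0] an
    edge to twin 0 of [cut p i]. Quantifying over [p] of value 0 reads the first bit without
    assuming [k > 0]. *)
Definition hard_edge (v w : hard_vertex) : bool :=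
  match v, w with
  | Some (inl _), None => true
  | Some (inl i), Some (inl j) =>
      (i == j) && [exists p : 'I_k, (p == 0 :> nat) && i p]
  | Some (inl i), Some (inr (j, c)) =>
      (c == ord0) &&
      ((j == i) || [exists p : 'I_k, [&& 0 < p, i p & j == cut p i]])
  | Some (inr (i, _)), Some (inl j) => i == j
  | _, _ => false
  end.

Definition hard_system : transition_system :=
  @TransitionSystem hard_vertex hard_edge unit (fun=> tt).

Local Notation S := hard_system.

Definition agree (n : nat) (i j : word) := forall p : 'I_k, p < n -> i p = j p.

Lemma agree_trans n i j h : agree n i j -> agree n j h -> agree n i h.
Proof. by move=> ij jh p pn; rewrite ij ?jh. Qed.

Lemma agree_sym n i j : agree n i j -> agree n j i.
Proof. by move=> ij p pn; rewrite ij. Qed.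

Lemma flipK l : involutive (flip l).
Proof. by move=> i; apply/ffunP=> p; rewrite !ffunE addbA addbb. Qed.

Lemma agree_flip (n : nat) (l : 'I_k) i : n <= l -> agree n i (flip l i).
Proof.
move=> nl p pn; rewrite ffunE; case: eqP => // pl.
by rewrite pl ltnNge nl in pn.
Qed.

Lemma cut_agree (n : nat) (p : 'I_k) i j : p <= n -> agree n i j -> cut p i = cut p j.
Proof.
move=> pn ij; apply/ffunP=> q; rewrite !ffunE.
case: ltnP => [qp | pq]; first by rewrite ij //; apply: leq_trans pn; apply: ltnW.
by case: eqP => //= qp; rewrite ij // qp.
Qed.

Lemma agree_cut (n : nat) (p : 'I_k) i : n < p -> agree n i (cut p i).
Proof. by move=> np q qn; rewrite ffunE (leq_ltn_trans qn np). Qed.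

(** * Size of the systems *)

Lemma card_vertices : nb_vertices S = (2 ^ k * k.+2).+1.
Proof.
rewrite /nb_vertices card_option card_sum card_prod card_ffun card_bool !card_ord.
by rewrite [in RHS]mulnS.
Qed.

Lemma card_edges_le : nb_edges S <= 2 ^ k * (2 * k + 4).
Proof.
(* [f] covers all edges, word by word: [k] to siblings, [k.+1] from the twins, and 3 for the sink,
   the loop and the own twin 0. *)
pose f (q : word * (('I_k + 'I_k.+1) + 'I_3)) : S * S :=
  match q with
  | (i, inl (inl p)) => (xv i, yv (cut p i) ord0)
  | (i, inl (inr c)) => (yv i c, xv i)
  | (i, inr h) => (xv i, nth sink [:: sink; xv i; yv i ord0] h)
  end.
have -> : 2 ^ k * (2 * k + 4) = #|{: word * (('I_k + 'I_k.+1) + 'I_3)}|.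
  rewrite card_prod !card_sum card_ffun card_bool !card_ord.
  by congr (_ * _); rewrite mul2n -addnn -!addnA; congr (_ + _); rewrite addSn -addnS.
apply: leq_trans (leq_imset_card f _); apply: subset_leq_card.
apply/subsetP=> -[[[i|[i c]]|] [[j|[j d]]|]]; rewrite inE //=.
- by case/andP=> /eqP <- _; apply/imsetP; exists (i, inr (@Ordinal 3 1 isT)).
- case/andP=> /eqP ->{d} /orP[/eqP ->|/existsP[p /and3P[_ _ /eqP ->]]].
    by apply/imsetP; exists (i, inr (@Ordinal 3 2 isT)).
  by apply/imsetP; exists (i, inl (inl p)).
- by move=> _; apply/imsetP; exists (i, inr (@Ordinal 3 0 isT)).
by move/eqP <-; apply/imsetP; exists (i, inl (inr c)).
Qed.

(** Induction on the number of common bits: a bit set in only one of two words yields a successor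
    that the other cannot match. The three kinds of vertices are told apart first, through the
    sink. *)
Lemma bisimulation_agree (r : rel S) (n : nat) i j :
  bisimulation r -> r (xv i) (xv j) -> agree n i j.
Proof.
case=> /equivalence_relP /= eqr bis.
have r_sym v w : r v w -> r w v.
  by case: eqr => rr rt vw; rewrite -(rt _ _ vw) rr.
have x_sink h : r (xv h) sink -> False.
  move=> /bis[_ /(_ sink)]; rewrite !inE => /(_ isT)[w].
  by rewrite inE.
have y_sink h c : r (yv h c) sink -> False.
  move=> /bis[_ /(_ (xv h))]; rewrite !inE /= eqxx => /(_ isT)[w].
  by rewrite inE.
have x_y h h' c : r (xv h) (yv h' c) -> False.
  move=> /bis[_ /(_ sink)]; rewrite !inE => /(_ isT)[[[w|w]|]]; rewrite inE //=.
  by move=> _ /r_sym /x_sink.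
have y_x h h' c c' : r (yv h c) (yv h' c') -> r (xv h) (xv h').
  move=> /bis[_ /(_ (xv h))]; rewrite !inE /= eqxx => /(_ isT)[[[w|w]|]];
    rewrite inE //=.
  by move/eqP->.
elim: n i j => [|n IHn] i j rij p; first by [].
rewrite ltnS leq_eqVlt => /orP[/eqP pn | ]; last exact: IHn.
have main (a b : word) : r (xv a) (xv b) -> a p -> b p.
  move=> rab ap; apply: contraT => /negPf bp; have ab := IHn _ _ rab.
  have [p0 | p_gt0] := posnP p.
    have [_ /(_ (xv a)) + _] := bis _ _ rab; rewrite inE /= eqxx /=.
    case=> [|[[w|[w c]]|]].
    - by apply/existsP; exists p; rewrite p0 ap.
    - rewrite inE /= => /andP[_ /existsP[q /andP[/eqP q0 bq]]].
      have qp : q = p by apply: val_inj; rewrite /= q0.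
      by rewrite -qp bq in bp.
    - by move=> _ /x_y.
    - by move=> _ /x_sink.
  have qk : p.-1 < k by apply: leq_ltn_trans (leq_pred _) (ltn_ord p).
  pose q := Ordinal qk; have qp : q.+1 = p by rewrite /= prednK.
  have qn : q < n by rewrite -pn -qp.
  have cutq : cut p a q = ~~ a q by rewrite ffunE qp ltnn eqxx.
  have [_ /(_ (yv (cut p a) ord0)) + _] := bis _ _ rab; rewrite inE /=.
  case=> [|[[w|[w c]]|]].
  - by apply/orP; right; apply/existsP; exists p; rewrite p_gt0 ap /=.
  - by move=> _ /r_sym /x_y.
  - rewrite inE /= => /andP[_ wE] /y_x /IHn aw.
    (* Here [w] must agree with [cut p a] below [p]. They differ at [p.-1] if [w = b] or [p' > p],
       at [p'.-1] if [p' < p], and [p' = p] contradicts [b p = false]. *)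
    case/orP: wE => [/eqP wb | /existsP[p' /and3P[p'_gt0 bp' /eqP wb]]].
      by have := aw q qn; rewrite cutq wb ab //; case: (b q).
    case: (ltngtP p' p) => [lt|gt|/val_inj eqp]; last by rewrite -eqp bp' in bp.
      have q'k : p'.-1 < k by apply: leq_ltn_trans (leq_pred _) (ltn_ord p').
      pose q' := Ordinal q'k; have q'p : q'.+1 = p' by rewrite /= prednK.
      have q'n : q' < n by rewrite -pn; apply: leq_trans (ltnW lt); rewrite -q'p.
      have := aw q' q'n; rewrite wb !ffunE q'p lt ltnn eqxx /= ab //.
      by case: (b q').
    have := aw q qn; rewrite cutq wb ffunE qp gt ab //.
    by case: (b q).
  - by move=> _ /y_sink.
by apply/idP/idP; apply: main => //; apply: r_sym.
Qed.

(* The potential function of the lower bound. *)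
Definition split_pairs (P : {set {set S}}) : {set 'I_k * word} :=
  [set p | ~~ @same_cell S P (yv p.2 ord0) (yv (flip p.1 p.2) ord0)].

(** Final value of the potential: the only successor of [yv i c] is [xv i], so an unsplit pair would
    make two different words agree. *)
Lemma split_pairs_bisimulation (P : {set {set S}}) :
  bisimulation (@same_cell S P) -> #|split_pairs P| = k * 2 ^ k.
Proof.
move=> bisP; have -> : split_pairs P = setT.
  apply/setP=> -[l i]; rewrite !inE /=; apply/negP=> yy.
  have [_ bis] := bisP; have [_ /(_ (xv i)) + _] := bis _ _ yy.
  rewrite inE /= eqxx => /(_ isT)[[[w|w]|]]; rewrite inE //= => /eqP <-.
  move=> /(@bisimulation_agree _ k _ _ bisP) /(_ l (ltn_ord l)).
  by rewrite ffunE eqxx /=; case: (i l).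
by rewrite cardsT card_prod card_ffun card_bool card_ord.
Qed.

(** The block of a prefix is given by its length [l] and any word [i] extending it; bit [l] selects
    the half. *)
Definition separated (P : {set {set S}}) (l : 'I_k) (i : word) :=
  forall j j' c c', agree l i j -> agree l i j' -> j l != j' l ->
  ~~ @same_cell S P (yv j c) (yv j' c').

Definition x_coherent (P : {set {set S}}) (l : 'I_k) (i : word) :=
  forall j j', agree l i j -> agree l i j' -> j l = j' l ->
  @same_cell S P (xv j) (xv j').

Definition y_coherent (P : {set {set S}}) (l : 'I_k) (i : word) :=
  forall j j' c c', agree l i j -> agree l i j' ->
  @same_cell S P (yv j c) (yv j' c').

(* Whether the y-block at (l, i) is cut is decided only by the cells of the two
   half blocks of x, so it can only be cut exactly into its halves. *)
Definition invariant (P : {set {set S}}) := forall l i,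
  separated P l i \/ (y_coherent P l i /\ x_coherent P l i).

Lemma same_hits_y (P : {set {set S}}) A i j c d :
  @same_hits S P A (yv i c) (yv j d) =
  [forall (C | (C \in P) && (C \subset A)), (xv i \in C) == (xv j \in C)].
Proof.
have hit h e (C : {set S}) : (@outn S (yv h e) :&: C != finset.set0) = (xv h \in C).
  apply/set0Pn/idP => [[[[w|w]|]] | hC].
  - by rewrite !inE /= => /andP[/eqP <-].
  - by rewrite !inE.
  - by rewrite !inE.
  by exists (xv h); rewrite !inE /= eqxx.
by apply: eq_forallb_in => C _; rewrite !hit.
Qed.

(** * Effect of one operation on the blocks and the potential *)

Section Step.
Variables (P : {set {set S}}) (A B : {set S}).
Hypotheses (partP : partition P [set: S]) (closedB : B \in closed_sets P).
Hypothesis invP : invariant P.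

Let P' := @refine S P A B.

Let x_hits j j' := @same_hits S P A (yv j ord0) (yv j' ord0).

Let x_hitsE j j' c c' : @same_hits S P A (yv j c) (yv j' c') = x_hits j j'.
Proof. by rewrite /x_hits !same_hits_y. Qed.

Let x_hits_cell j j' a a' : @same_cell S P (xv j) (xv a) ->
  @same_cell S P (xv j') (xv a') -> x_hits j j' = x_hits a a'.
Proof.
move=> ja ja'; rewrite /x_hits !same_hits_y.
apply: eq_forallb_in => C /andP[CP _].
by rewrite (same_cell_in partP CP ja) (same_cell_in partP CP ja').
Qed.

Let cellP' := @same_cell_refine S P A B partP closedB.

(** Words in the same half share their first [l.+1] bits; each successor of one [x]-vertex then has
    a counterpart, in the same cell of [P], among the successors of the other. *)
Let step_x_coherent l i :
  y_coherent P l i -> x_coherent P l i -> x_coherent P' l i.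
Proof.
move=> yco xco j j' ij ij' jl; rewrite cellP' xco //=; apply/implyP=> _.
suff sub a a' : agree l i a -> agree l i a' -> a l = a' l -> forall C : {set S},
    C \in P -> @outn S (xv a) :&: C != finset.set0 ->
    @outn S (xv a') :&: C != finset.set0.
  by apply/forall_inP=> C /andP[CP _]; apply/eqP; apply/idP/idP; apply: sub.
move=> {j j' ij ij' jl} ia ia' al C CP.
have aa' : agree l.+1 a a'.
  move=> p; rewrite ltnS leq_eqVlt => /orP[/eqP/val_inj -> // | pl].
  by rewrite -ia // ia'.
case/set0Pn=> w /setIP[aw wC]; apply/set0Pn.
suff [w' a'w' ww'] : exists2 w' : S, @edge S (xv a') w' & @same_cell S P w w'.
  by exists w'; rewrite !inE a'w' -(same_cell_in partP CP ww').
move: aw {wC}; rewrite inE; case: w => [[w|[w d]]|] /=.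
- case/andP=> /eqP <-{w} /existsP[p /andP[/eqP p0 ap]].
  exists (xv a'); last exact: xco.
  by rewrite /= eqxx; apply/existsP; exists p; rewrite p0 -aa' ?p0 ?ap.
- case/andP=> /eqP ->{d} /orP[/eqP ->|/existsP[p /and3P[p0 ap /eqP ->]]].
    by exists (yv a' ord0); rewrite /= ?eqxx //; apply: yco.
  (* For [p <= l] both words have an edge to the same vertex, as [cut p] reads only shared bits. For
     [p > l] the target lies in the uncut block, so twin 0 of [a'] replaces it. *)
  case: (leqP p l) => pl.
    exists (yv (cut p a) ord0); last by rewrite /same_cell eqxx.
    rewrite /=; apply/orP; right; apply/existsP; exists p.
    rewrite p0 -aa' // ap /= (@cut_agree l _ a a') //.
    exact: agree_trans (agree_sym ia) ia'.
  exists (yv a' ord0); rewrite /= ?eqxx //; apply: yco => //.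
  by apply: agree_trans ia (agree_cut _ pl).
by exists sink => //; rewrite /same_cell eqxx.
Qed.

(** Separation persists because cells never merge. An uncut block lies in [B] or outside it as a
    whole; inside [B] it is cut exactly when the hits of [i] and [flip l i] differ. *)
Lemma refine_invariant : invariant P'.
Proof.
move=> l i; case: (invP l i) => [sep | [yco xco]].
  by left=> j j' c c' ij ij' jl; rewrite cellP' negb_and sep.
have xco' := step_x_coherent yco xco.
have [inB | offB] := boolP (yv i ord0 \in B); last first.
  right; split=> // j j' c c' ij ij'; rewrite cellP' yco //=.
  by rewrite -(closed_same_cell partP closedB (yco _ _ ord0 c (fun _ _ => erefl) ij))
    (negPf offB).
have allB j c : agree l i j -> (yv j c \in B).
  by move=> ij; rewrite -(closed_same_cell partP closedB (yco _ _ ord0 c (fun _ _ => erefl) ij)).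
have ifl : agree l i (flip l i) by apply: agree_flip.
have ii : agree l i i by [].
(* [i] and [flip l i] represent the two halves, and the [x]-vertices of one half share a cell. *)
have half j j' : agree l i j -> agree l i j' -> j l != j' l ->
    x_hits j j' = x_hits i (flip l i).
  move=> ij ij' jl; have [jil | jil] := eqVneq (j l) (i l).
    apply: x_hits_cell; apply: xco => //; rewrite ffunE eqxx -jil.
    by move: jl; case: (j l); case: (j' l).
  rewrite /x_hits same_hits_sym; apply: x_hits_cell; apply: xco => //.
    by move: jl jil; case: (j l); case: (j' l); case: (i l).
  by rewrite ffunE eqxx; move: jil; case: (j l); case: (i l).
case: (boolP (x_hits i (flip l i))) => hit; [right; split=> // | left].
  move=> j j' c c' ij ij'; rewrite cellP' yco //= allB //= x_hitsE.
  have [jl | jl] := eqVneq (j l) (j' l); last by rewrite half.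
  rewrite (@x_hits_cell j j' j' j') ?/x_hits ?same_hits_refl //; apply: xco => //.
by move=> j j' c c' ij ij' jl; rewrite cellP' negb_and allB //= x_hitsE half // hit orbT.
Qed.

Let new_pairs := split_pairs P' :\: split_pairs P.

(** A pair in a separated block was counted before, so a new pair comes from an uncut block. *)
Let new_pairP l i : (l, i) \in new_pairs ->
  [/\ y_coherent P l i, x_coherent P l i, yv i ord0 \in B &
      ~~ x_hits i (flip l i)].
Proof.
rewrite !inE negbK /= => /andP[same diff].
have ii : agree l i i by [].
case: (invP l i) => [sep | [yco xco]].
  have := sep i (flip l i) ord0 ord0 ii (agree_flip _ (leqnn _)).
  by rewrite same ffunE eqxx => /(_ _)/negP; case; case: (i l).
by move: diff; rewrite cellP' same negb_imply => /andP[].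
Qed.

Let new_pair_flip l i : (l, i) \in new_pairs -> (l, flip l i) \in new_pairs.
Proof.
rewrite !inE /= flipK => /andP[].
by rewrite /same_cell ![pblock _ (yv (flip l i) ord0) == _]eq_sym => -> ->.
Qed.

(** If [a < b] and the block at level [a] was uncut, then [xv i] and [xv (flip b i)] belong to the
    same half of it and share a cell, so the operation cannot split the pair at level [b]. *)
Let new_pair_uniq l l' i :
  (l, i) \in new_pairs -> (l', i) \in new_pairs -> l = l'.
Proof.
have noless a b : (a, i) \in new_pairs -> (b, i) \in new_pairs -> a < b -> False.
  move=> /new_pairP[_ xco _ _] /new_pairP[_ _ _ /negP nh] ab; apply: nh.
  rewrite (@x_hits_cell i (flip b i) i i) ?/x_hits ?same_hits_refl //.
    by rewrite /same_cell.
  apply: xco => //; first by apply: agree_flip; apply: ltnW.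
  by rewrite ffunE; case: eqP => // e; rewrite e ltnn in ab.
move=> h h'; case: (ltngtP l l') => [lt|gt|/val_inj //]; exfalso.
  exact: noless lt.
exact: noless gt.
Qed.

(** Words whose [k.+1] edges from the twins to the [x]-vertex all count in the cost of the
    operation. *)
Let paid := [set i | (xv i \in A) && [forall c, yv i c \in B]].

Let card_paid : k.+1 * #|paid| <= @op_cost S A B.
Proof.
rewrite mulnC -[k.+1]card_ord -cardsT -cardsX.
pose f (q : word * 'I_k.+1) : S * S := (yv q.1 q.2, xv q.1).
have injf : injective f by move=> [i c] [j d] [-> ->].
rewrite -(card_imset _ injf); apply/subset_leq_card/subsetP=> _ /imsetP[[i c] + ->].
by rewrite !inE andbT => /andP[iA /forallP iB]; rewrite /= iB iA eqxx.
Qed.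

(** Some cell inside [A] contains exactly one of the two [x]-vertices, so one of them lies in [A];
    all twins lie in [B], which contains the uncut block. *)
Let new_pair_paid l i : (l, i) \in new_pairs ->
  (if xv i \in A then i else flip l i) \in paid.
Proof.
move=> new; have [yco xco iB] := new_pairP new.
have allB j c : agree l i j -> yv j c \in B.
  by move=> ij; rewrite -(closed_same_cell partP closedB (yco _ _ ord0 c (fun _ _ => erefl) ij)).
rewrite /x_hits same_hits_y negb_forall_in => /exists_inP[C /andP[CP /subsetP CA]].
move=> hit; rewrite inE; case: ifP => iA.
  by rewrite iA /=; apply/forallP=> c; apply: allB.
apply/andP; split; last by apply/forallP=> c; apply/allB/agree_flip.
apply: (CA); move: hit; have [/CA|_] := boolP (xv i \in C); first by rewrite iA.
by case: (xv (flip l i) \in C).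
Qed.

(* A new pair (l, i) is charged to whichever of i and flip l i has its x-vertex
   in A; since an operation creates at most one new pair per word, this is at
   most two-to-one. *)
Let card_new_pairs : #|new_pairs| <= 2 * #|paid|.
Proof.
pose g (q : 'I_k * word) :=
  (xv q.2 \in A, if xv q.2 \in A then q.2 else flip q.1 q.2).
have injg : {in new_pairs &, injective g}.
  move=> [l i] [l' i'] new new' [/= eA].
  rewrite -eA; case: ifP => _ eqi.
    by rewrite -eqi in new' *; rewrite (new_pair_uniq new new').
  (* Both pairs charge their flipped word; the flipped pairs are new as well and share that word, so
     uniqueness applies to it. *)
  have nf := new_pair_flip new; have nf' := new_pair_flip new'.
  rewrite -eqi in nf'; have el := new_pair_uniq nf nf'; rewrite -el in eqi *.
  by rewrite (can_inj (flipK l) eqi).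
rewrite -(card_in_imset injg) -card_bool -[#|{: bool}|]cardsT -cardsX.
apply/subset_leq_card/subsetP=> _ /imsetP[[l i] new ->].
by rewrite in_setX inE /= new_pair_paid.
Qed.

Lemma refine_potential :
  k.+1 * #|split_pairs P'| <= k.+1 * #|split_pairs P| + 2 * @op_cost S A B.
Proof.
have le : #|split_pairs P'| <= #|split_pairs P| + #|new_pairs|.
  by rewrite -(cardsID (split_pairs P) (split_pairs P')) leq_add2r subset_leq_card ?subsetIr.
apply: (leq_trans (leq_mul (leqnn k.+1) le)); rewrite mulnDr leq_add2l.
apply: leq_trans (leq_mul (leqnn 2) card_paid).
by rewrite mulnCA leq_mul2l card_new_pairs orbT.
Qed.

End Step.

Lemma run_potential (P : {set {set S}}) ops :
  partition P [set: S] -> invariant P -> effective_ops P ops ->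
  k.+1 * #|split_pairs (run_ops P ops)| <=
  k.+1 * #|split_pairs P| + 2 * ops_cost ops.
Proof.
elim: ops P => [|[A B] ops IHops] P pP iP /=; first by rewrite /ops_cost big_nil addn0.
case/and4P=> _ cB _ eff; rewrite /ops_cost big_cons /= mulnDr addnA.
apply: (leq_trans (IHops _ _ _ eff)); first exact: refine_partition.
  exact: refine_invariant.
by rewrite leq_add2r refine_potential.
Qed.

(** The potential climbs from 0 at the unit partition, where every block is uncut, to
    [k * 2 ^ k]. *)
Lemma refining_sequence_cost ops :
  @refining_sequence S (unit_partition S) ops ->
  k.+1 * (k * 2 ^ k) <= 2 * ops_cost ops.
Proof.
case=> eff [[_ bis] _ _]; rewrite -(split_pairs_bisimulation bis).
have unit_cell := @same_cell_unit S.
have -> : 2 * ops_cost ops = k.+1 * #|split_pairs (unit_partition S)| + 2 * ops_cost ops.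
  suff -> : split_pairs (unit_partition S) = finset.set0 by rewrite cards0 muln0.
  by apply/setP=> p; rewrite !inE unit_cell.
apply: run_potential => //; first exact: (@unit_partitionP S sink).
by move=> l i; right; split=> ? ? *; apply: unit_cell.
Qed.

End Hard.

(** * Asymptotic bounds *)

Lemma bcost_hard_system k :
  k.+1 * (k * 2 ^ k) <= 2 * bcost (unit_partition (hard_system k)).
Proof.
have [//||ops opsP <-] :=
  @bcost_attained (hard_system k) (unit_partition (hard_system k)).
  exact: (@unit_partitionP (hard_system k) (sink k)).
exact: refining_sequence_cost.
Qed.

(** A crude bound suffices, since it only serves to bound the logarithm linearly in [k]. *)
Lemma nb_vertices_le_exp k : 2 <= k -> nb_vertices (hard_system k) <= 2 ^ (3 * k).
Proof.
move=> k2; have -> : 2 ^ (3 * k) = 2 ^ k * 2 ^ k * 2 ^ k by rewrite -!expnD; congr (2 ^ _); lia.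
rewrite card_vertices.
have := ltn_expl k (isT : 1 < 2); have : 2 ^ 2 <= 2 ^ k by rewrite leq_exp2l.
by move: (2 ^ k) => e; nia.
Qed.

Import Order.TTheory GRing.Theory Num.Theory.
Local Open Scope classical_set_scope.
Local Open Scope ring_scope.

Lemma ln_nb_vertices_le (R : realType) k : (2 <= k)%N ->
  ln (nb_vertices (hard_system k))%:R <= 6 * k%:R :> R.
Proof.
move=> k2; have n_gt0 : (0 < (nb_vertices (hard_system k))%:R :> R).
  by rewrite ltr0n card_vertices.
apply: (@le_trans _ _ (ln ((2 : R) ^+ (3 * k)))).
  rewrite ler_ln ?posrE ?exprn_gt0 // -natrX ler_nat.
  exact: nb_vertices_le_exp.
rewrite lnXn // -(mulr_natr (ln 2)) natrM mulrA ler_wpM2r ?ler0n //.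
by have := @ln_sublinear R 2 (ltr0n _ 2); lra.
Qed.

(** The divergence clause excludes trivial families such as one-vertex systems, for which the
    logarithm is 0. *)
Theorem theorem7 (R : realType) :
  exists S : nat -> transition_system,
    nb_vertices (S k) @[k --> \oo] --> \oo /\
    exists a b c : R, [/\ 0 < a, 0 < b, 0 < c &
      forall k : nat, (2 <= k)%N ->
        [/\ constant_label (S k),
            (nb_vertices (S k))%:R <= a * (2 ^ k * k)%N%:R,
            (nb_edges (S k))%:R <= b * (2 ^ k * k ^ 2)%N%:R &
            c * (nb_edges (S k) + nb_vertices (S k))%N%:R
              * ln (nb_vertices (S k))%:R
            <= (bcost (unit_partition (S k)))%:R]].
Proof.
exists hard_system; split.
  apply/cvgnyPge => N; exists N => // k /= Nk; rewrite card_vertices.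
  have := ltn_expl k (isT : (1 < 2)%N); move: (2 ^ k)%N => e; nia.
(* With [m + n <= 7 * 2 ^ k * k], [ln n <= 6 * k] and [2 ^ k * k ^ 2 <= 2 * bcost], the product is
   at most [7 * 6 * 2 = 84] times [bcost]. *)
exists 3, 4, 84^-1; split; rewrite ?invr_gt0 ?ltr0n // => k k2.
have e_ge4 : (2 ^ 2 <= 2 ^ k)%N by rewrite leq_exp2l.
have n_le : (nb_vertices (hard_system k) <= 3 * (2 ^ k * k))%N.
  by rewrite card_vertices; move: (2 ^ k)%N e_ge4 => e; nia.
have m_le : (nb_edges (hard_system k) <= 4 * (2 ^ k * k))%N.
  by apply: leq_trans (card_edges_le k) _; move: (2 ^ k)%N e_ge4 => e; nia.
split=> //.
- by rewrite -natrM ler_nat.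
- by rewrite -natrM ler_nat (leq_trans m_le) //; move: (2 ^ k)%N => e; nia.
have size_le : (nb_edges (hard_system k) + nb_vertices (hard_system k))%:R
    <= 7 * (2 ^ k * k)%:R :> R.
  by rewrite -natrM ler_nat; lia.
have cost_ge : (2 ^ k * k)%:R * k%:R <= 2 * (bcost (unit_partition (hard_system k)))%:R :> R.
  rewrite -!natrM ler_nat; apply: leq_trans (bcost_hard_system k).
  by move: (2 ^ k)%N => e; nia.
have ln_ge0 : 0 <= ln (nb_vertices (hard_system k))%:R :> R.
  by rewrite ln_ge0 // ler1n card_vertices.
have := ler_pM (ler0n R _) ln_ge0 size_le (ln_nb_vertices_le R k2).
by rewrite -!mulrA; lra.
Qed.
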